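(* Let $(A,A_r^* )$ be a factorizable Zinbiel bialgebra. Then $\mathrm{Im}(r_+\oplus r_-)=\{(r_+(\xi),r_-(\xi)):\xi\in A^*\}$ is a Zinbiel subalgebra of the direct sum Zinbiel algebra $A\oplus A$, which is isomorphic to the Zinbiel algebra $(A^*,\cdot_r)$. Moreover, any $x\in A$ has a unique decomposition $x=x_+-x_-$ with $(x_+,x_-)\in\mathrm{Im}(r_+\oplus r_-)$.
   Context: All vector spaces are finite-dimensional over a field $\mathbb{K}$ of characteristic different from $2$. A Zinbiel algebra $(A,\circ_A)$ is a vector space with a bilinear product satisfying $x\circ_A(y\circ_A z)=(x\circ_A y+y\circ_A x)\circ_A z$. Write $x\ast_A y=x\circ_A y+y\circ_A x$, $L_x(y)=x\circ_A y$, $R_x(y)=y\circ_A x$, $\langle L_x^*\xi,y\rangle=-\langle\xi,x\circ_A y\rangle$, $\langle R_x^*\xi,y\rangle=-\langle\xi,y\circ_A x\rangle$ ($\xi\in A^*$). For $r=\sum_i a_i\otimes b_i\in A\otimes A$ define $r_\pm:A^*\to A$ by $\langle r_+(\xi),\eta\rangle=r(\xi,\eta)=\langle\xi,r_-(\eta)\rangle$, put $I=r_+-r_-:A^*\to A$, let $a$ be the skew-symmetric part of $r$, and let $$[\![r,r]\!]=\sum_{i,j}\big(-a_i\circ_A a_j\otimes b_j\otimes b_i-b_j\otimes a_i\circ_A a_j\otimes b_i+a_i\ast_A b_j\otimes a_j\otimes b_i+a_i\otimes b_i\ast_A a_j\otimes b_j-a_i\otimes a_j\otimes b_i\ast_A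 b_j\big).$$ An element $s\in A\otimes A$ is $(L,L+R)$-invariant if $(L_x\otimes\mathrm{Id}-\mathrm{Id}\otimes(L_x+R_x))s=0$ for all $x\in A$. If $[\![r,r]\!]=0$ and $a$ is $(L,L+R)$-invariant, then $\alpha(x)=(\mathrm{Id}\otimes(L_x+R_x)-L_x\otimes\mathrm{Id})r$ makes $(A,A^* )$ a Zinbiel bialgebra with product $\xi\cdot_r\eta=-(L^*_{r_+(\xi)}+R^*_{r_+(\xi)})\eta+R^*_{r_-(\eta)}\xi$ on $A^*$ (denoted $A_r^*$); this $(A,A_r^* )$ is called the quasi-triangular Zinbiel bialgebra induced by $r$. It is called factorizable if $a$ is nondegenerate, i.e. if $I:A^*\to A$ is a linear isomorphism. (A Zinbiel bialgebra is a pair of Zinbiel algebra structures on $A$ and $A^*$, dual to maps $\beta:A^*\to A^*\otimes A^*$ and $\alpha:A\to A\otimes A$ respectively, with $\alpha(x\ast_A y)=(L_x\otimes\mathrm{Id})\alpha(y)+(\mathrm{Id}\otimes(L_y+R_y))\alpha(x)$ and $\beta(\xi\ast_{A^*}\eta)=(\mathcal{L}_\xi\otimes\mathrm{Id})\beta(\eta)+(\mathrm{Id}\otimes(\mathcal{L}_\eta+\mathcal{R}_\eta))\beta(\xi)$, where $\mathcal{L},\mathcal{R}$ are left and right multiplications of $A^*$ and $\xi\ast_{A^*}\eta$ is the symmetrized product of $A^*$.) *)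

(* Defs.v *)
From HB Require Import structures.
From mathcomp Require Import all_boot all_order all_algebra.
Set Implicit Arguments.
Unset Strict Implicit.
Unset Printing Implicit Defensive.
Import GRing.Theory.
Local Open Scope ring_scope.

Notation dual V := 'Hom(V, GRing.regular _).

(** In finite dimension V ⊗ W is Hom(V^*, W), where v ⊗ w is the map
    xi |-> <xi, v> w.  Lemmas [tdecE] and [tdec_sum] say that pure tensors span
    and that a bilinear expression summed over a decomposition into pure tensors
    does not depend on the decomposition, which is the universal property. *)
Definition tensor (K : fieldType) (V W : vectType K) : vectType K :=
  'Hom(dual V, W).

Section TensorProduct.
Variable K : fieldType.

Definition tpure_fun (V W : vectType K) (v : V) (w : W) (xi : dual V) : W :=
  xi v *: w.

Fact tpure_fun_linear (V W : vectType K) (v : V) (w : W) :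
  linear (tpure_fun v w).
Proof.
by move=> k x y; rewrite /tpure_fun add_lfunE scale_lfunE scalerDl scalerA.
Qed.

HB.instance Definition _ (V W : vectType K) v w :=
  GRing.isLinear.Build K (dual V) W _ (@tpure_fun V W v w)
    (tpure_fun_linear v w).

Definition tpure (V W : vectType K) (v : V) (w : W) : tensor V W :=
  linfun (tpure_fun v w).

End TensorProduct.

Notation "v ⊗ w" := (tpure v w) (at level 40, left associativity) : ring_scope.

Section TensorTheory.
Variable K : fieldType.

Lemma tpureE (V W : vectType K) (v : V) (w : W) (xi : dual V) :
  (v ⊗ w : 'Hom(dual V, W)) xi = xi v *: w.
Proof. by rewrite lfunE. Qed.

Fact tpure_bilinear (V W : vectType K) :
  bilinear_for *:%R *:%R (@tpure K V W).
Proof.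
split=> [w k x y|v k x y]; apply/lfunP=> xi;
  rewrite add_lfunE scale_lfunE !tpureE.
  by rewrite linearP scalerDl scalerA.
by rewrite scalerDr !scalerA mulrC.
Qed.

HB.instance Definition _ (V W : vectType K) :=
  bilinear_isBilinear.Build K V W (tensor V W) *:%R *:%R (@tpure K V W)
    (tpure_bilinear V W).

Definition cobasis (V : vectType K) (i : 'I_(\dim {:V})) : dual V :=
  linfun (coord (vbasis {:V}) i : V -> K^o).

(** A decomposition of a tensor t as the sum of the p.1 ⊗ p.2. *)
Definition tdec (V W : vectType K) (t : tensor V W) : seq (V * W) :=
  [seq ((vbasis {:V})`_i, (t : 'Hom(dual V, W)) (cobasis i))
     | i : 'I_(\dim {:V})].

Lemma cobasisE (V : vectType K) (i : 'I_(\dim {:V})) (v : V) :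
  cobasis i v = coord (vbasis {:V}) i v.
Proof. by rewrite lfunE. Qed.

Lemma cobasis_sum (V : vectType K) (xi : dual V) :
  \sum_(i < \dim {:V}) xi (vbasis {:V})`_i *: cobasis i = xi.
Proof.
apply/lfunP=> v; rewrite sum_lfunE {2}(coord_vbasis (memvf v)) linear_sum /=.
apply: eq_bigr => i _; rewrite scale_lfunE cobasisE linearZ /=.
by rewrite /GRing.scale /= mulrC.
Qed.

Lemma tdecE (V W : vectType K) (t : tensor V W) :
  \sum_(p <- tdec t) p.1 ⊗ p.2 = t.
Proof.
rewrite big_map big_enum /=; apply/lfunP=> xi; rewrite sum_lfunE.
rewrite -{2}(cobasis_sum xi) linear_sum; apply: eq_bigr => i _ /=.
by rewrite tpureE linearZ.
Qed.

Lemma tdec_sum_bilinear (V W U : vectType K) (g : {bilinear V -> W -> U})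
    (s : seq (V * W)) :
  \sum_(p <- tdec (\sum_(q <- s) q.1 ⊗ q.2)) g p.1 p.2
    = \sum_(q <- s) g q.1 q.2.
Proof.
rewrite big_map big_enum /=.
transitivity (\sum_(i < \dim {:V}) \sum_(q <- s)
    g (vbasis {:V})`_i (coord (vbasis {:V}) i q.1 *: q.2)).
  apply: eq_bigr => i _; rewrite sum_lfunE linear_sumr.
  by apply: eq_bigr => q _; rewrite tpureE cobasisE.
rewrite exchange_big /=; apply: eq_bigr => q _.
rewrite {2}(coord_vbasis (memvf q.1)) linear_sumlz.
by apply: eq_bigr => i _; rewrite linearZr_LR linearZl_LR.
Qed.

Lemma tdec_sum (V W U : vectType K) (f : V -> W -> U) (s : seq (V * W)) :
    bilinear_for *:%R *:%R f ->
  \sum_(p <- tdec (\sum_(q <- s) q.1 ⊗ q.2)) f p.1 p.2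
    = \sum_(q <- s) f q.1 q.2.
Proof.
move=> fP.
pose B := bilinear_isBilinear.Build K V W U *:%R *:%R f fP.
exact: (tdec_sum_bilinear (HB.pack f B : {bilinear V -> W -> U})).
Qed.

Definition tflip (V W : vectType K) (t : tensor V W) : tensor W V :=
  \sum_(p <- tdec t) p.2 ⊗ p.1.

Definition tmap (V W V' W' : vectType K) (f : 'Hom(V, V')) (g : 'Hom(W, W'))
    (t : tensor V W) : tensor V' W' :=
  \sum_(p <- tdec t) f p.1 ⊗ g p.2.

Definition tpair (V W : vectType K) (t : tensor V W) (xi : dual V)
    (eta : dual W) : K^o :=
  \sum_(p <- tdec t) xi p.1 * eta p.2.

Definition tskew (V : vectType K) (t : tensor V V) : tensor V V :=
  2%:R^-1 *: (t - tflip t).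

End TensorTheory.

Section Zinbiel.
Variable K : fieldType.

Section Product.
Variables (A : vectType K) (m : {bilinear A -> A -> A}).

Definition zinbiel : Prop := forall x y z, m x (m y z) = m (m x y + m y x) z.

Definition zsym (x y : A) : A := m x y + m y x.

Fact zsym_bilinear : bilinear_for *:%R *:%R zsym.
Proof.
by split=> [z k x y|z k x y]; rewrite /zsym /= linearPl linearPr scalerDr addrACA.
Qed.

HB.instance Definition _ :=
  bilinear_isBilinear.Build K A A A *:%R *:%R zsym zsym_bilinear.

Definition zL (x : A) : 'End(A) := linfun (m x).

Definition zR (x : A) : 'End(A) := linfun (applyr m x).

Definition zLstar (x : A) (xi : dual A) : dual A := - (xi \o zL x)%VF.

Definition zRstar (x : A) (xi : dual A) : dual A := - (xi \o zR x)%VF.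

(** The product of A restricted to a subspace U; [vsproj U] is the identity on
    the values that it gets as soon as U is a subalgebra. *)
Definition zsub (U : {vspace A}) (u v : subvs_of U) : subvs_of U :=
  vsproj U (m (vsval u) (vsval v)).

Definition zsubalgebra (U : {vspace A}) : Prop :=
  {in U &, forall x y, m x y \in U}.

Fact zsub_bilinear (U : {vspace A}) : bilinear_for *:%R *:%R (@zsub U).
Proof.
by split=> [z k x y|z k x y]; rewrite /zsub linearP ?linearPl ?linearPr linearP.
Qed.

HB.instance Definition _ (U : {vspace A}) :=
  bilinear_isBilinear.Build K (subvs_of U) (subvs_of U) (subvs_of U)
    *:%R *:%R (@zsub U) (zsub_bilinear U).

Section RMatrix.
Variable r : tensor A A.

Definition zbracket_term (ai bi aj bj : A) : tensor A (tensor A A) :=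
  - (m ai aj ⊗ (bj ⊗ bi)) - bj ⊗ (m ai aj ⊗ bi) + zsym ai bj ⊗ (aj ⊗ bi)
  + ai ⊗ (zsym bi aj ⊗ bj) - ai ⊗ (aj ⊗ zsym bi bj).

Definition zbracket : tensor A (tensor A A) :=
  \sum_(p <- tdec r) \sum_(q <- tdec r) zbracket_term p.1 p.2 q.1 q.2.

Lemma zbracketE (s : seq (A * A)) : r = \sum_(p <- s) p.1 ⊗ p.2 ->
  zbracket = \sum_(p <- s) \sum_(q <- s) zbracket_term p.1 p.2 q.1 q.2.
Proof.
have bilD (V W U : vectType K) (f g : V -> W -> U) :
    bilinear_for *:%R *:%R f -> bilinear_for *:%R *:%R g ->
    bilinear_for *:%R *:%R (fun v w => f v w + g v w).
  move=> [fl fr] [gl gr]; split=> [w k x y|v k x y] /=.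
    by rewrite [f _ _]fl [g _ _]gl scalerDr addrACA.
  by rewrite [f _ _]fr [g _ _]gr scalerDr addrACA.
have bilN (V W U : vectType K) (f : V -> W -> U) :
    bilinear_for *:%R *:%R f -> bilinear_for *:%R *:%R (fun v w => - f v w).
  move=> [fl fr]; split=> [w k x y|v k x y] /=.
    by rewrite [f _ _]fl opprD scalerN.
  by rewrite [f _ _]fr opprD scalerN.
have bilT_cd a b : bilinear_for *:%R *:%R (zbracket_term a b).
  rewrite /zbracket_term; repeat first [apply: (@bilD _ _ _) | apply: (@bilN _ _ _)];
    by split=> [w k x y|v k x y]; rewrite /= ?(linearPl, linearPr).
have bilT_ab c d :
    bilinear_for *:%R *:%R (fun a b => zbracket_term a b c d).
  rewrite /zbracket_term; repeat first [apply: (@bilD _ _ _) | apply: (@bilN _ _ _)];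
    by split=> [w k x y|v k x y]; rewrite /= ?(linearPl, linearPr).
move=> rE; rewrite /zbracket rE.
under eq_bigr => p _ do rewrite (tdec_sum _ (bilT_cd p.1 p.2)).
rewrite exchange_big [RHS]exchange_big /=; apply: eq_bigr => q _.
by rewrite (tdec_sum _ (bilT_ab q.1 q.2)).
Qed.

Definition LLR_invariant (s : tensor A A) : Prop :=
  forall x, tmap (zL x) \1%VF s - tmap \1%VF (zL x + zR x) s = 0.

(** r itself, as a map A^* -> A, is r_+; its transpose is r_-.  See [rplusP]
    and [rminusP]. *)
Definition rplus : 'Hom(dual A, A) := r.

Definition rminus : 'Hom(dual A, A) := tflip r.

Definition rI : 'Hom(dual A, A) := rplus - rminus.

Definition rprod (xi eta : dual A) : dual A :=
  - (zLstar (rplus xi) eta + zRstar (rplus xi) eta) + zRstar (rminus eta) xi.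

Lemma rplusP (xi eta : dual A) : eta (rplus xi) = tpair r xi eta.
Proof.
rewrite /rplus -{1}(tdecE r) sum_lfunE linear_sum.
by apply: eq_bigr => p _; rewrite tpureE linearZ.
Qed.

Lemma rminusP (xi eta : dual A) : xi (rminus eta) = tpair r xi eta.
Proof.
rewrite /rminus sum_lfunE linear_sum.
by apply: eq_bigr => p _; rewrite tpureE linearZ /= mulrC.
Qed.

Lemma rprodE (xi eta : dual A) (x : A) :
  rprod xi eta x = eta (zsym (rplus xi) x) - xi (m x (rminus eta)).
Proof.
rewrite /rprod /zLstar /zRstar !(add_lfunE, opp_lfunE, comp_lfunE, lfunE) /=.
by rewrite opprD !opprK -linearD.
Qed.

Fact rprod_bilinear : bilinear_for *:%R *:%R rprod.
Proof.
split=> [z k x y|z k x y]; apply/lfunP=> w;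
  rewrite [RHS]add_lfunE [X in _ = X + _]scale_lfunE !rprodE.
  rewrite add_lfunE scale_lfunE [rplus _]linearP linearPl [z _]linearP /=.
  by rewrite scalerBr opprD addrACA.
rewrite add_lfunE scale_lfunE [rminus _]linearP linearPr [z _]linearP /=.
by rewrite scalerBr opprD addrACA.
Qed.

HB.instance Definition _ :=
  bilinear_isBilinear.Build K (dual A) (dual A) (dual A) *:%R *:%R rprod
    rprod_bilinear.

(** The conditions on r under which (A, A_r^* ) is the quasi-triangular Zinbiel
    bialgebra induced by r.  The compatibility of the bialgebra structure is a
    consequence of these conditions. *)
Definition quasi_triangular : Prop :=
  zbracket = 0 /\ LLR_invariant (tskew r).

Definition factorizable : Prop := quasi_triangular /\ bijective rI.

Definition rpm (xi : dual A) : (A * A)%type := (rplus xi, rminus xi).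

Fact rpm_linear : linear rpm.
Proof. by move=> k x y; rewrite /rpm !linearP. Qed.

HB.instance Definition _ :=
  GRing.isLinear.Build K (dual A) (A * A)%type _ rpm rpm_linear.

Definition im_rpm : {vspace (A * A)%type} := limg (linfun rpm).

End RMatrix.
End Product.

Definition zdsum (A B : vectType K) (m : {bilinear A -> A -> A})
    (n : {bilinear B -> B -> B}) (x y : (A * B)%type) : (A * B)%type :=
  (m x.1 y.1, n x.2 y.2).

Fact zdsum_bilinear (A B : vectType K) (m : {bilinear A -> A -> A})
    (n : {bilinear B -> B -> B}) : bilinear_for *:%R *:%R (zdsum m n).
Proof.
by split=> [z k x y|z k x y]; rewrite /zdsum /= ?linearPl ?linearPr.
Qed.

HB.instance Definition _ (A B : vectType K) (m : {bilinear A -> A -> A})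
    (n : {bilinear B -> B -> B}) :=
  bilinear_isBilinear.Build K (A * B)%type (A * B)%type (A * B)%type
    *:%R *:%R (zdsum m n) (zdsum_bilinear m n).

Lemma zdsum_zinbiel (A B : vectType K) (m : {bilinear A -> A -> A})
    (n : {bilinear B -> B -> B}) :
  zinbiel m -> zinbiel n -> zinbiel (zdsum m n).
Proof.
by move=> hm hn x y z; exact: (congr2 pair (hm _ _ _) (hn _ _ _)).
Qed.

Definition zinbiel_isomorphic (A B : vectType K) (m : {bilinear A -> A -> A})
    (n : {bilinear B -> B -> B}) : Prop :=
  [/\ zinbiel m, zinbiel n &
      exists f : 'Hom(A, B), bijective f /\ {morph f : x y / m x y >-> n x y}].

End Zinbiel.

(* Main.v *)
(** Both [rplus] and [rminus] are homomorphisms from (A^*, ._r) to A.  Pairing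
    [[r,r]] = 0 with xi, eta, zeta gives a trilinear identity in r_+ and r_-;
    the invariance of the skew-symmetric part reads
    <eta, x * I xi> = - <xi, x o I eta>, and these two together with
    r_+ = r_- + I give the homomorphism property.  Since I = r_+ - r_- is
    injective, so is (r_+, r_-), which embeds (A^*, ._r) as a subalgebra of
    A (+) A; since I is bijective, x = r_+ xi - r_- xi has exactly one solution
    xi. *)
Require Import Defs.
From HB Require Import structures.
From mathcomp Require Import all_boot all_order all_algebra.
From mathcomp Require Import ring.
Set Implicit Arguments.
Unset Strict Implicit.
Unset Printing Implicit Defensive.
Import GRing.Theory.
Local Open Scope ring_scope.

Section Duality.
Variables (K : fieldType) (A : vectType K).

Lemma dual_sepP (x y : A) : (forall xi : dual A, xi x = xi y) -> x = y.
Proof.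
move=> h; rewrite (coord_vbasis (memvf x)) (coord_vbasis (memvf y)).
by apply: eq_bigr => i _; rewrite -!cobasisE h.
Qed.

(** Meant for products of values of [r_+] and [r_-], which are such sums over [tdec r]. *)
Lemma bilinear_sumZ (f : {bilinear A -> A -> A}) (xi : dual A)
    (I : Type) (s : seq I) (c d : I -> K) (u v : I -> A) :
  xi (f (\sum_(p <- s) c p *: u p) (\sum_(q <- s) d q *: v q)) =
  \sum_(p <- s) \sum_(q <- s) c p * (d q * (xi (f (u p) (v q)) : K)) :> K.
Proof.
rewrite linear_sumlz linear_sum /=; apply: eq_bigr => p _.
rewrite linear_sumr linear_sum /=; apply: eq_bigr => q _.
by rewrite linearZl_LR linearZr_LR !linearZ.
Qed.

Lemma tmap_pair (V W V' W' : vectType K) (f : 'Hom(V, V')) (g : 'Hom(W, W'))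
    (t : tensor V W) (xi : dual V') (eta : dual W') :
  eta ((tmap f g t : 'Hom(dual V', W')) xi)
    = tpair t (xi \o f)%VF (eta \o g)%VF.
Proof.
rewrite /tmap sum_lfunE linear_sum /=; apply: eq_bigr => p _.
by rewrite tpureE linearZ /= !comp_lfunE.
Qed.

End Duality.

(** An injective morphism reflects identities, so [rprod] inherits its Zinbiel identity from A (+) A
    without a direct computation. *)
Lemma inj_morph_zinbiel (K : fieldType) (A B : vectType K)
    (m : {bilinear A -> A -> A}) (n : {bilinear B -> B -> B})
    (f : {linear A -> B}) :
  injective f -> {morph f : x y / m x y >-> n x y} -> zinbiel n -> zinbiel m.
Proof.
by move=> fI fM hn x y z; apply: fI; rewrite !(fM, linearD) hn.
Qed.

Section Factorizable.
Variables (K : fieldType) (A : vectType K) (m : {bilinear A -> A -> A}).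
Variable r : tensor A A.

Local Notation T := (rplus r).
Local Notation S := (rminus r).
Local Notation J := (rI r).

Lemma rplus_sum (xi : dual A) : T xi = \sum_(p <- tdec r) (xi p.1 : K) *: p.2.
Proof.
rewrite /rplus -{1}(tdecE r) sum_lfunE.
by apply: eq_bigr => p _; rewrite tpureE.
Qed.

Lemma rminus_sum (xi : dual A) : S xi = \sum_(p <- tdec r) (xi p.2 : K) *: p.1.
Proof.
by rewrite /rminus sum_lfunE; apply: eq_bigr => p _; rewrite tpureE.
Qed.

Lemma rplus_rminus (xi eta : dual A) : eta (T xi) = xi (S eta).
Proof. by rewrite rplusP rminusP. Qed.

Lemma rplus_split (xi : dual A) : T xi = S xi + J xi.
Proof. by rewrite /rI add_lfunE opp_lfunE addrC subrK. Qed.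

Lemma rI_skew (xi eta : dual A) : eta (J xi) = - xi (J eta).
Proof.
rewrite /rI !add_lfunE !opp_lfunE !linearB /= !rplus_rminus.
by rewrite opprK addrC.
Qed.

(** [T] contracts the first leg of [r] and [S] the second, so both sides are double sums over
    [tdec r] that agree term by term. *)
Lemma zbracket_pair (xi eta zeta : dual A) :
  zeta ((zbracket m r : 'Hom(dual A, tensor A A)) xi eta) =
  - xi (m (S zeta) (S eta)) - eta (m (S zeta) (S xi))
  + xi (zsym m (S zeta) (T eta)) + eta (zsym m (T xi) (S zeta))
  - zeta (zsym m (T xi) (T eta)) :> K.
Proof.
rewrite !rplus_sum !rminus_sum !bilinear_sumZ.
rewrite /zbracket sum_lfunE sum_lfunE linear_sum /=.
rewrite -!sumrN -!big_split /=; apply: eq_bigr => p _.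
rewrite sum_lfunE sum_lfunE linear_sum /=.
rewrite -!sumrN -!big_split /=; apply: eq_bigr => q _.
rewrite /zbracket_term !(add_lfunE, opp_lfunE, tpureE, scale_lfunE).
rewrite !linearD !linearN !linearZ /= /GRing.scale /=.
ring.
Qed.

Hypothesis two_neq0 : (2%:R : K) != 0.
Hypothesis inv_a : LLR_invariant m (tskew r).

(** As a map, [tskew r] is [J] divided by 2; pairing the invariance with [xi] and [eta] and using
    skewness of [J] gives this once 2 is cancelled. *)
Lemma rI_invariant (x : A) (xi eta : dual A) :
  eta (zsym m x (J xi)) = - xi (m x (J eta)).
Proof.
have skewE zeta : (tskew r : 'Hom(dual A, A)) zeta = 2%:R^-1 *: J zeta.
  by rewrite /tskew scale_lfunE.
have LE y : zL m x y = m x y by rewrite lfunE.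
have LRE y : (zL m x + zR m x) y = zsym m x y by rewrite add_lfunE !lfunE.
have := congr1 (fun t : tensor A A => eta ((t : 'Hom(dual A, A)) xi)) (inv_a x).
rewrite /= add_lfunE opp_lfunE linearB /= !tmap_pair -!rplusP /rplus !skewE.
rewrite zero_lfunE linear0 !comp_lfunE !linearZ /= !id_lfunE.
rewrite -scalerDr => /eqP; rewrite scaler_eq0 invr_eq0 (negPf two_neq0) /=.
by rewrite comp_lfun1r rI_skew comp_lfunE LE LRE subr_eq0 => /eqP <-.
Qed.

(** By [rI_invariant] in both orders, each side equals [- (xi (m x (J eta)) + eta (m x (J xi)))],
    which is symmetric in [xi] and [eta]. *)
Lemma rI_invariant_left (x : A) (xi eta : dual A) :
  xi (m (J eta) x) = eta (m (J xi) x).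
Proof.
have := rI_invariant x xi eta; have := rI_invariant x eta xi.
rewrite /zsym !linearD /= => h1 h2.
rewrite -(addKr (xi (m x (J eta))) (xi _)) h1.
by rewrite -(addKr (eta (m x (J xi))) (eta (m _ x))) h2 addrC.
Qed.

Hypothesis bracket0 : zbracket m r = 0.

Lemma zbracket0_pair (xi eta zeta : dual A) :
  eta (zsym m (T xi) (T zeta)) =
  xi (m (S zeta) (S eta)) + zeta (m (T xi) (S eta)) :> K.
Proof.
have := zbracket_pair xi zeta eta; rewrite bracket0 !zero_lfunE linear0.
have -> : zsym m (S eta) (T zeta) =
    zsym m (S eta) (S zeta) + zsym m (S eta) (J zeta).
  by rewrite rplus_split linearDr.
have -> : zeta (zsym m (T xi) (S eta)) =
    zeta (m (T xi) (S eta)) + zeta (m (S eta) (S xi)) + zeta (m (S eta) (J xi)).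
  by rewrite {1}/zsym (rplus_split xi) linearDr !linearD /= addrA.
(* The two terms in [J] left after splitting [T] as [S + J] cancel by this instance. *)
have inv2 := rI_invariant (S eta) zeta xi.
rewrite [xi (_ + zsym _ _ _)]linearD /= inv2 {1}/zsym [xi (_ + _)]linearD /=.
move=> /esym/eqP; rewrite subr_eq0 => /eqP <-.
ring.
Qed.

Lemma rplus_morph : {morph T : xi eta / rprod m r xi eta >-> m xi eta}.
Proof.
move=> xi eta; apply: dual_sepP => zeta.
rewrite rplus_rminus rprodE.
have inv1 := rI_invariant (T xi) zeta eta.
have := zbracket0_pair xi eta zeta.
(* Invariance moves [J] from [zeta] to [eta], where it turns [S eta] into [T eta]. *)
rewrite {1}(rplus_split zeta) linearDr linearD /= inv1 => /(canRL (addrK _)) ->.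
rewrite (rplus_split eta) linearDr !linearD /=.
ring.
Qed.

Lemma rminus_morph : {morph S : xi eta / rprod m r xi eta >-> m xi eta}.
Proof.
move=> xi eta; apply: dual_sepP => zeta.
rewrite -rplus_rminus rprodE zbracket0_pair.
(* Here [J] moves from [zeta] to [xi], in a left factor, turning [T xi] into [S xi]. *)
have := rI_invariant_left (S eta) xi zeta.
rewrite (rplus_split zeta) (rplus_split xi) !linearDl !linearD /= => ->.
ring.
Qed.

Hypothesis J_bij : bijective J.

Lemma rpm_inj : injective (rpm r).
Proof.
by move=> x y [hT hS]; apply: (bij_inj J_bij);
  rewrite /rI !add_lfunE !opp_lfunE hT hS.
Qed.

Lemma rpm_morph :
  {morph rpm r : xi eta / rprod m r xi eta >-> zdsum m m xi eta}.
Proof.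
by move=> xi eta; rewrite /rpm /zdsum /= rplus_morph rminus_morph.
Qed.

Lemma mem_im_rpm (xi : dual A) : rpm r xi \in im_rpm r.
Proof. by rewrite -(lfunE (rpm r)) memv_img ?memvf. Qed.

Lemma im_rpmP (p : (A * A)%type) : p \in im_rpm r -> exists xi, p = rpm r xi.
Proof. by case/memv_imgP => xi _ ->; exists xi; rewrite lfunE. Qed.

Lemma im_rpm_subalgebra : zsubalgebra (zdsum m m) (im_rpm r).
Proof.
by move=> _ _ /im_rpmP[x ->] /im_rpmP[y ->]; rewrite /= -rpm_morph mem_im_rpm.
Qed.

Lemma im_rpm_isomorphic : zinbiel m ->
  zinbiel_isomorphic (zsub (zdsum m m) (U:=im_rpm r)) (rprod m r).
Proof.
move=> hm; have hmm := zdsum_zinbiel hm hm.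
have vsM (u v : subvs_of (im_rpm r)) : vsval (zsub (zdsum m m) u v) =
    zdsum m m (vsval u) (vsval v) :> (A * A)%type.
  by apply: vsprojK; exact: im_rpm_subalgebra (subvsP u) (subvsP v).
split.
- exact: (@inj_morph_zinbiel _ _ _ _ (zdsum m m) vsval subvs_inj vsM hmm).
- exact: (@inj_morph_zinbiel _ _ _ _ (zdsum m m) (rpm r) rpm_inj rpm_morph hmm).
have kerf : lker (linfun (rpm r)) == 0%VS.
  by apply/lker0P => x y; rewrite !lfunE; apply: rpm_inj.
(* The inverse of [rpm r] on its image; injectivity makes [^-1%VF] a true left inverse there. *)
pose f : 'Hom(subvs_of (im_rpm r), dual A) :=
  linfun ((linfun (rpm r))^-1%VF \o vsval).
have fE u : rpm r (f u) = vsval u.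
  rewrite lfunE /=; have /im_rpmP[x ->] := subvsP u.
  by rewrite -(lfunE (rpm r) x) lker0_lfunK // lfunE.
exists f; split.
  exists (fun x => vsproj (im_rpm r) (rpm r x)) => [u|x].
    by rewrite fE vsvalK.
  by apply: rpm_inj; rewrite fE vsprojK // mem_im_rpm.
by move=> u v; apply: rpm_inj; rewrite rpm_morph !fE vsM.
Qed.

Lemma im_rpm_decomposition (x : A) :
  exists! p : (A * A)%type, p \in im_rpm r /\ x = p.1 - p.2.
Proof.
have JE xi : J xi = (rpm r xi).1 - (rpm r xi).2.
  by rewrite /rI add_lfunE opp_lfunE.
(* The difference of the components of [rpm r xi] is [J xi], which forces [xi = g x]. *)
have [g gK Kg] := J_bij; exists (rpm r (g x)); split.
  by rewrite -JE Kg mem_im_rpm.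
by move=> _ [/im_rpmP[y ->]]; rewrite -JE => ->; rewrite gK.
Qed.

End Factorizable.

Theorem proposition4p18 (K : fieldType) (hK : 2%N \notin [pchar K])
    (A : vectType K) (m : {bilinear A -> A -> A}) (hm : zinbiel m)
    (r : tensor A A) (hr : factorizable m r) :
  [/\ zsubalgebra (zdsum m m) (im_rpm r),
      zinbiel_isomorphic (zsub (zdsum m m) (U:=im_rpm r)) (rprod m r)
    & forall x : A,
        exists! p : (A * A)%type, p \in im_rpm r /\ x = p.1 - p.2].
Proof.
(* As 2 is prime, membership in [pchar] reduces to [2%:R == 0]. *)
have two_neq0 : (2%:R : K) != 0 by move: hK; rewrite inE.
have [[bracket0 inv_a] J_bij] := hr.
split.
- exact: im_rpm_subalgebra.
- exact: im_rpm_isomorphic.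
- exact: im_rpm_decomposition.
Qed.
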